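(* Let $(X,\to,{}^*,1)$ be a quasi-linear quantum-Wajsberg algebra, and let $\mathcal{Z}(X)=\{x\in X\mid x\Cap y=y\Cap x\text{ for all }y\in X\}$. Then $\mathcal{Z}(X)$, with the operations restricted from $X$, is a linearly ordered Wajsberg algebra (with respect to the order $x\le y$ iff $x\to y=1$).
   Context: A BE algebra is an algebra $(X,\to,1)$ of type $(2,0)$ such that for all $x,y,z\in X$: $x\to x=1$; $x\to 1=1$; $1\to x=x$; $x\to(y\to z)=y\to(x\to z)$. Write $x\le y$ iff $x\to y=1$. It is bounded if there is $0\in X$ with $0\le x$ for all $x$; then $x^*:=x\to 0$. A bounded BE algebra is involutive if $x^{**}=x$ for all $x$; it is written $(X,\to,{}^*,1)$, with $0=1^*$. In an involutive BE algebra put $x\Cup y=(x\to y)\to y$, $x\Cap y=((x^*\to y^* )\to y^* )^*$, and $x\le_Q y$ iff $x=x\Cap y$. A quantum-Wajsberg algebra is an involutive BE algebra $(X,\to,{}^*,1)$ satisfying, for all $x,y,z\in X$, $x\to((x\Cap y)\Cap(z\Cap x))=(x\to y)\Cap(x\to z)$. It is quasi-linear if for all $x,y\in X$, $x\not\le_Q y$ implies $y<x$, where $y<x$ means $y\le x$ and $y\ne x$. A Wajsberg algebra is an algebra $(W,\to,{}^*,1)$ of type $(2,1,0)$ such that for all $x,y,z$: $1\to x=x$; $(y\to z)\to((z\to x)\to(y\to x))=1$; $(x\to y)\to y=(y\to x)\to x$; $(x^*\to y^* )\to(y\to x)=1$. It is partially ordered by $x\le y$ iff $x\to y=1$. *)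

(* Defs.v *)
From Stdlib Require Export Relation_Definitions.

Set Implicit Arguments.
Unset Strict Implicit.
Unset Printing Implicit Defensive.

Declare Scope qw_scope.
Delimit Scope qw_scope with qw.
Local Open Scope qw_scope.

Record BE_algebra (X : Type) (imp : X -> X -> X) (one : X) : Prop := {
  BE_refl : forall x, imp x x = one;
  BE_top : forall x, imp x one = one;
  BE_unit : forall x, imp one x = x;
  BE_exchange : forall x y z, imp x (imp y z) = imp y (imp x z)
}.

Record bounded_BE_algebra (X : Type) (imp : X -> X -> X) (one zero : X) :
    Prop := {
  bounded_BE : BE_algebra imp one;
  bounded_bot : forall x, imp zero x = one
}.

(* Algebras of type (2,1,0), with no axioms. *)
Record algebra : Type := Algebra {
  carrier :> Type;
  imp : carrier -> carrier -> carrier;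
  star : carrier -> carrier;
  one : carrier
}.

Arguments one {a}.

Notation "x --> y" := (imp x y) (at level 55, right associativity) : qw_scope.
Notation "x ^*" := (star x) (at level 2, format "x ^*") : qw_scope.

Definition le (A : algebra) (x y : A) : Prop := x --> y = one.

Definition lt (A : algebra) (x y : A) : Prop := le x y /\ x <> y.

(* The bottom element is not a separate operation: it is [one^*]. *)
Record involutive_BE_algebra (A : algebra) : Prop := {
  inv_bounded : bounded_BE_algebra (@imp A) one (one^*);
  inv_star : forall x : A, x^* = x --> one^*;
  inv_invol : forall x : A, x^*^* = x
}.

Definition Cap (A : algebra) (x y : A) : A := ((x^* --> y^*) --> y^*)^*.

Definition leQ (A : algebra) (x y : A) : Prop := x = Cap x y.

Record quantum_Wajsberg_algebra (A : algebra) : Prop := {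
  QW_inv : involutive_BE_algebra A;
  QW_axiom : forall x y z : A,
    x --> Cap (Cap x y) (Cap z x) = Cap (x --> y) (x --> z)
}.

Definition quasi_linear (A : algebra) : Prop :=
  forall x y : A, ~ leQ x y -> lt y x.

Record Wajsberg_algebra (A : algebra) : Prop := {
  W_unit : forall x : A, one --> x = x;
  W_trans : forall x y z : A,
    (y --> z) --> ((z --> x) --> (y --> x)) = one;
  W_comm : forall x y : A, (x --> y) --> y = (y --> x) --> x;
  W_contra : forall x y : A, (x^* --> y^*) --> (y --> x) = one
}.

Definition linear_order (T : Type) (R : relation T) : Prop :=
  order T R /\ forall x y : T, R x y \/ R y x.

Definition center (A : algebra) (x : A) : Prop :=
  forall y : A, Cap x y = Cap y x.

Record subuniverse (A : algebra) (P : A -> Prop) : Prop := {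
  sub_imp : forall x y, P x -> P y -> P (x --> y);
  sub_star : forall x, P x -> P (x^*);
  sub_one : P one
}.

Definition restrict (A : algebra) (P : A -> Prop) (H : subuniverse P) :
    algebra :=
  {| carrier := {x : A | P x};
     imp u v := exist P (proj1_sig u --> proj1_sig v)
                        (sub_imp H (proj2_sig u) (proj2_sig v));
     star u := exist P ((proj1_sig u)^*) (sub_star H (proj2_sig u));
     one := exist P one (sub_one H) |}.

(* Main.v *)
(** The relation [a <=_Q b] holds iff [b = t --> a] for some [t].  Since
    [s --> t --> a = u^* --> a] with [u = s --> t^*], this makes [<=_Q] transitive and
    [-->] monotone in its second argument.  In a quasi-linear algebra, [x] is
    central iff it is [<=_Q]-comparable with every element, and for central [x]
    the hypothesis [y <= x] upgrades to [y <=_Q x].  Suppose [x], [y] are central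
    and [z <= x --> y].  Either [z <=_Q y <=_Q x --> y], or [y <=_Q z]; in the
    latter case [x <=_Q z --> y], whence
    [z = (z --> y) --> y <=_Q x --> y]. *)

Require Import Defs.
From Stdlib Require Import Classical ProofIrrelevance.

Set Implicit Arguments.

Local Open Scope qw_scope.

Section InvolutiveBE.

Variables (X : algebra) (hX : involutive_BE_algebra X).
Implicit Types x y z : X.

Let BE := bounded_BE (inv_bounded hX).

Lemma imp_refl x : x --> x = one.
Proof. apply (BE_refl BE). Qed.

Lemma imp_one x : x --> one = one.
Proof. apply (BE_top BE). Qed.

Lemma one_imp x : one --> x = x.
Proof. apply (BE_unit BE). Qed.

Lemma imp_exchange x y z : x --> y --> z = y --> x --> z.
Proof. apply (BE_exchange BE). Qed.

Lemma bot_imp x : one^* --> x = one.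
Proof. apply (bounded_bot (inv_bounded hX)). Qed.

Lemma starK x : x^*^* = x.
Proof. apply (inv_invol hX). Qed.

Lemma imp_bot x : x --> one^* = x^*.
Proof. symmetry; apply (inv_star hX). Qed.

Lemma imp_star_star x y : x^* --> y^* = y --> x.
Proof.
now rewrite <- (imp_bot y), imp_exchange, imp_bot, starK.
Qed.

Lemma imp_starr x y : x --> y^* = y --> x^*.
Proof. now rewrite <- (imp_star_star (x^*) y), starK. Qed.

Lemma imp_assoc x y z : x --> y --> z = (x --> y^*)^* --> z.
Proof.
rewrite <- (imp_star_star z y), <- (imp_star_star z ((x --> y^*)^*)), starK.
apply imp_exchange.
Qed.

Lemma le_imp x y : le y (x --> y).
Proof. unfold le. now rewrite imp_exchange, imp_refl, imp_one. Qed.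

Lemma Cap_star x y : (Cap (x^*) (y^*))^* = (x --> y) --> y.
Proof. unfold Cap. now rewrite !starK. Qed.

Lemma Cap_le_r x y : le (Cap x y) y.
Proof.
unfold le, Cap. rewrite <- imp_star_star, starK. apply le_imp.
Qed.

Lemma Cap_of_ge x y : le y x -> Cap x y = y.
Proof.
unfold le, Cap. intros H. now rewrite imp_star_star, H, one_imp, starK.
Qed.

Lemma leQ_le x y : leQ x y -> le x y.
Proof. intros H. rewrite H. apply Cap_le_r. Qed.

Lemma Cap_one_l x : Cap one x = x.
Proof. apply Cap_of_ge, imp_one. Qed.

Lemma Cap_one_r x : Cap x one = x.
Proof. unfold Cap. now rewrite !imp_bot, !starK. Qed.

Lemma Cap_bot_l x : Cap (one^*) x = one^*.
Proof. unfold Cap. now rewrite starK, one_imp, imp_refl. Qed.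

Lemma Cap_bot_r x : Cap x (one^*) = one^*.
Proof. apply Cap_of_ge, bot_imp. Qed.

Lemma center_one : center (one : X).
Proof. intros y. now rewrite Cap_one_l, Cap_one_r. Qed.

Lemma leQ_Cap_comm x y : leQ x y -> Cap x y = Cap y x.
Proof.
intros H. rewrite (Cap_of_ge (leQ_le H)). now symmetry.
Qed.

Lemma center_leQ x y : center x -> le y x -> leQ y x.
Proof.
intros Hx H. unfold leQ. now rewrite <- (Hx y), Cap_of_ge.
Qed.

Lemma center_of_comparable x :
  (forall y, leQ x y \/ leQ y x) -> center x.
Proof.
intros H y. destruct (H y) as [Hy | Hy].
- now apply leQ_Cap_comm.
- symmetry. now apply leQ_Cap_comm.
Qed.

Lemma quasi_linear_center_comparable x :
  quasi_linear X -> center x -> forall y, leQ x y \/ leQ y x.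
Proof.
intros hlin Hx y. destruct (classic (leQ x y)) as [H | H]; [now left | right].
apply center_leQ; [exact Hx | apply (hlin _ _ H)].
Qed.

End InvolutiveBE.

Section QuantumWajsberg.

Variables (X : algebra) (hX : quantum_Wajsberg_algebra X).
Implicit Types x y z : X.

Let hI := QW_inv hX.

(** Instance of [QW_axiom] whose second variable is the bottom [one^*]: the inner meets collapse to
    [one^*]. The facts on [leQ] below all rest on it. *)
Lemma leQ_star_imp x y : leQ (x^*) (x --> y).
Proof.
unfold leQ. rewrite <- (imp_bot hI x), <- (QW_axiom hX).
now rewrite (Cap_bot_r hI), (Cap_bot_l hI).
Qed.

Lemma leQ_imp x y : leQ y (x --> y).
Proof.
rewrite <- (imp_star_star hI), <- (starK hI y) at 1. apply leQ_star_imp.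
Qed.

(* With [t := y --> x], [x = Cap x y] reads [x^* = t --> y^*], so
   [t --> x] is the join [(y --> u) --> u] for [u = t^*], which is [y] because [y^* <=_Q t]. *)
Lemma leQ_join x y : leQ x y -> (y --> x) --> x = y.
Proof.
intros H. set (t := y --> x).
assert (Hx : x^* = y --> t^*).
{ unfold leQ, Cap in H. rewrite (imp_star_star hI) in H.
  rewrite H at 1. rewrite (starK hI). apply (imp_starr hI). }
rewrite <- (imp_star_star hI x t), Hx, <- (Cap_star hI), (starK hI).
rewrite <- (leQ_star_imp y x : y^* = Cap (y^*) t). apply (starK hI).
Qed.

Lemma leQ_trans x y z : leQ x y -> leQ y z -> leQ x z.
Proof.
intros Hxy Hyz.
(* Writing [z], then [y], as a join gives [z = (z --> y) --> (y --> x) --> x]; residuation merges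
   the two premises. *)
assert (E : ((z --> y) --> (y --> x)^*)^* --> x = z)
  by now rewrite <- (imp_assoc hI), (leQ_join Hxy), (leQ_join Hyz).
rewrite <- E. apply leQ_imp.
Qed.

Lemma leQ_star x y : leQ x y -> leQ (y^*) (x^*).
Proof.
intros H. unfold leQ.
now rewrite <- (starK hI (Cap _ _)), (Cap_star hI), (leQ_join H).
Qed.

Lemma leQ_imp2l x y z : leQ x y -> leQ (z --> x) (z --> y).
Proof.
intros H. rewrite <- (leQ_join H), (imp_exchange hI). apply leQ_imp.
Qed.

Lemma leQ_imp2r x y z : leQ x y -> leQ (y --> z) (x --> z).
Proof.
intros H. rewrite <- (imp_star_star hI z y), <- (imp_star_star hI z x).
now apply leQ_imp2l, leQ_star.
Qed.

Hypothesis hlin : quasi_linear X.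

Lemma center_star x : center x -> center (x^*).
Proof.
intros Hx. apply (center_of_comparable hI). intros y.
rewrite <- (starK hI y).
destruct (quasi_linear_center_comparable hI hlin Hx (y^*)) as [H | H].
- right. now apply leQ_star.
- left. now apply leQ_star.
Qed.

Lemma center_imp x y : center x -> center y -> center (x --> y).
Proof.
intros Hx Hy. apply (center_of_comparable hI). intros z.
destruct (classic (leQ (x --> y) z)) as [H | H]; [now left | right].
apply hlin in H. destruct H as [H _].
destruct (quasi_linear_center_comparable hI hlin Hy z) as [Hyz | Hzy].
(* With [z] written as [(z --> y) --> y], antitonicity leaves [leQ x (z --> y)]. *)
- rewrite <- (leQ_join Hyz). apply leQ_imp2r.
  destruct (quasi_linear_center_comparable hI hlin Hx (z --> y)) as [K | K];
    [exact K |].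
  (* Exchange turns [le z (x --> y)] into [le x (z --> y)]; centrality of [x] then makes it
     [leQ]. *)
  assert (E : Cap (z --> y) x = x).
  { apply (Cap_of_ge hI). unfold le. now rewrite (imp_exchange hI). }
  unfold leQ. now rewrite (Hx _), E.
- exact (leQ_trans Hzy (leQ_imp x y)).
Qed.

Lemma center_subuniverse : subuniverse (@center X).
Proof.
split.
- exact center_imp.
- exact center_star.
- exact (center_one hI).
Qed.

(** Both joins are stars of meets of [x^*] and [y^*], and [x^*] is central. *)
Lemma center_join_comm x y :
  center x -> (x --> y) --> y = (y --> x) --> x.
Proof.
intros Hx. rewrite <- !(Cap_star hI). f_equal. now apply center_star.
Qed.

(* Commuting the join gives
   [(z --> x) --> (y --> x) = y --> (z --> x) --> x = (x --> z) --> (y --> z)]. *)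
Lemma center_imp_trans x y z :
  center x -> (y --> z) --> ((z --> x) --> (y --> x)) = one.
Proof.
intros Hx. rewrite (imp_exchange hI (z --> x) y x).
rewrite <- (center_join_comm z Hx), (imp_exchange hI y).
apply (le_imp hI).
Qed.

End QuantumWajsberg.

Lemma restrict_eq (A : algebra) (P : A -> Prop) (H : subuniverse P)
    (u v : restrict H) : proj1_sig u = proj1_sig v -> u = v.
Proof.
destruct u as [x Hx], v as [y Hy]. apply subset_eq_compat.
Qed.

Lemma le_restrict (A : algebra) (P : A -> Prop) (H : subuniverse P)
    (u v : restrict H) : le u v <-> le (proj1_sig u) (proj1_sig v).
Proof.
split; intros E.
- exact (f_equal (@proj1_sig _ _) E).
- now apply restrict_eq.
Qed.

Theorem proposition3p21 (X : algebra) (hX : quantum_Wajsberg_algebra X)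
    (hlin : quasi_linear X) :
  exists H : subuniverse (@center X),
    Wajsberg_algebra (restrict H) /\ linear_order (@le (restrict H)).
Proof.
pose proof (QW_inv hX) as hI.
exists (center_subuniverse hX hlin). split; [split | split; [split |]].
- intros [x Hx]. apply restrict_eq, (one_imp hI).
- intros [x Hx] [y Hy] [z Hz]. apply restrict_eq. simpl.
  now apply center_imp_trans.
- intros [x Hx] [y Hy]. apply restrict_eq. simpl.
  now apply center_join_comm.
- intros [x Hx] [y Hy]. apply restrict_eq. simpl.
  now rewrite (imp_star_star hI), (imp_refl hI).
- intros [x Hx]. apply le_restrict, (imp_refl hI).
- intros [x Hx] [y Hy] [z Hz] Hxy Hyz.
  apply le_restrict in Hxy, Hyz. apply le_restrict. simpl in *.
  (* Transitivity is available for [leQ]; centrality of each upper element, [y] and then [z], lifts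
     [le] to it. *)
  apply (leQ_le hI), (leQ_trans hX (y := y)); now apply (center_leQ hI).
- intros [x Hx] [y Hy] Hxy Hyx.
  apply le_restrict in Hxy, Hyx. apply restrict_eq. simpl in *.
  (* [x = Cap y x = Cap x y = y], the middle equality by centrality of [y]. *)
  rewrite <- (Cap_of_ge hI Hxy), (Hy x). now apply (Cap_of_ge hI).
- intros [x Hx] [y Hy]. rewrite !le_restrict. simpl.
  destruct (quasi_linear_center_comparable hI hlin Hx y) as [H | H];
    [left | right]; now apply (leQ_le hI).
Qed.
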